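(* For every $\epsilon>0$ (and every $k$), there is a two-sided, adaptive distribution-free testing algorithm for $\epsilon$-testing $k$-juntas that makes $\tilde O(k/\epsilon)$ queries to $f$.
   Context: A function $f:\{0,1\}^n\to\{0,1\}$ is a $k$-junta if it depends on at most $k$ of its variables. For a probability distribution $\mathcal D$ on $\{0,1\}^n$, $f$ is $\epsilon$-far from $g$ with respect to $\mathcal D$ if $\Pr_{x\sim\mathcal D}[f(x)\neq g(x)]\ge\epsilon$, and $f$ is $\epsilon$-far from every $k$-junta with respect to $\mathcal D$ if this holds for every $k$-junta $g$. In the distribution-free testing model, the algorithm receives $\epsilon$ (and $k$) and has access to two oracles: a black box that returns $f(x)$ for any queried $x\in\{0,1\}^n$, and a sampling oracle that returns independent samples $x\in\{0,1\}^n$ drawn from an arbitrary, unknown distribution $\mathcal D$. The algorithm must (1) output ''accept'' with probability at least $2/3$ if $f$ is a $k$-junta, and (2) output ''reject'' with probability at least $2/3$ if $f$ is $\epsilon$-far from every $k$-junta with respect to $\mathcal D$. ''Two-sided'' means the algorithm may err in both cases (it is not required to always accept $k$-juntas); ''adaptive'' means queries may depend on answers to previous queries. The query complexity is the number of queries made to $f$ (samples from $\mathcal D$ are not counted as queries). $\tilde O(\cdot)$ hides factors polylogarithmic in $k/\epsilon$. *)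

(* Defs.v *)
From HB Require Import structures.
From mathcomp Require Import all_boot all_order all_algebra.
From mathcomp Require Import Rstruct.
From Stdlib Require Rdefinitions Rpower.
Set Implicit Arguments. Unset Strict Implicit. Unset Printing Implicit Defensive.
Import Order.TTheory GRing.Theory Num.Theory.
Local Open Scope ring_scope.

Notation R := Rdefinitions.R.

Definition bits (n : nat) := {ffun 'I_n -> bool}.

Definition is_junta (n k : nat) (f : bits n -> bool) : Prop :=
  exists S : {set 'I_n}, (#|S| <= k)%N /\
    forall x y : bits n, (forall i, i \in S -> x i = y i) -> f x = f y.

Definition is_distr (n : nat) (D : bits n -> R) : Prop :=
  (forall x, 0 <= D x) /\ \sum_(x : bits n) D x = 1.

Definition distD (n : nat) (D : bits n -> R) (f g : bits n -> bool) : R :=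
  \sum_(x : bits n | f x != g x) D x.

Definition far_from_juntas (n k : nat) (eps : R) (D : bits n -> R)
    (f : bits n -> bool) : Prop :=
  forall g : bits n -> bool, is_junta k g -> eps <= distD D f g.

(* Adaptive query strategy: a decision tree querying the black box f. *)
Inductive qtree (n : nat) : Type :=
  | Leaf of bool                        (* output: true = accept *)
  | Query of bits n & (bool -> qtree n).

Fixpoint run (n : nat) (t : qtree n) (f : bits n -> bool) : bool * nat :=
  match t with
  | Leaf b => (b, 0%N)
  | Query x c => let r := run (c (f x)) f in (r.1, r.2.+1)
  end.

(* A randomized distribution-free tester on {0,1}^n: it draws a uniform random
   seed in 'I_seedsz.+1 and nsamp i.i.d. samples from D (samples are free),
   and then adaptively queries f according to the resulting query tree. *)
Record tester (n : nat) := Tester {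
  seedsz : nat;
  nsamp : nat;
  strat : 'I_seedsz.+1 -> nsamp.-tuple (bits n) -> qtree n }.

Definition acc_prob (n : nat) (A : tester n) (D : bits n -> R)
    (f : bits n -> bool) : R :=
  \sum_(s : 'I_(seedsz A).+1) \sum_(xs : (nsamp A).-tuple (bits n))
     ((seedsz A).+1%:R)^-1 * (\prod_(i < nsamp A) D (tnth xs i)) *
     (if (run (strat s xs) f).1 then 1 else 0).

Definition max_queries (n : nat) (A : tester n) (qb : R) : Prop :=
  forall (s : 'I_(seedsz A).+1) (xs : (nsamp A).-tuple (bits n)) (f : bits n -> bool),
    ((run (strat s xs) f).2)%:R <= qb.

(* Main.v *)
(* A simplified form of Bshouty's tester. Random points cut the coordinates into about
   k^2 cells, so that the relevant variables of a k-junta typically lie in distinct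
   cells. The tester collects cells on which [f] visibly depends: whenever a sample
   [x] satisfies [f x <> f (x_X 0)], where [X] is the union of the cells found so far,
   a binary search over the cells yields a new cell [Z] and a point [v] such that the
   restriction of [f] to [Z] around [v] is not constant; more than k cells lead to
   rejection. For a k-junta this restriction is a literal. A linearity test together
   with a multiplicativity test ensures that the self-correction [h (y + z) + h z] of
   such a restriction [h] is a single coordinate (or 0) of [y]. Finally, on fresh
   samples [x], the coordinates so decoded are copied over their whole cells, and [f]
   at the resulting point is compared with [f (x_X 0)]. If this succeeds, [f] is close
   to a function of the at most k decoded coordinates. A k-junta is rejected only when
   two of its relevant variables fall in the same cell. *)

Require Import Defs.
From HB Require Import structures.
From mathcomp Require Import all_boot all_order all_algebra.
From mathcomp Require Import Rstruct ring lra zify.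
From Stdlib Require Rdefinitions Rpower.
Set Implicit Arguments. Unset Strict Implicit. Unset Printing Implicit Defensive.
Import Order.TTheory GRing.Theory Num.Theory.
Local Open Scope ring_scope.

(** * Randomized query programs *)

Inductive source := Coins | Samples.

(** Internal randomness consists of uniform points of the cube, so coin tosses and samples from [D]
    share one constructor. The tree form makes expectations, sure events and query bounds structural
    recursions. *)
Inductive prog (n : nat) (A : Type) : Type :=
  | Ret of A
  | Ask of bits n & (bool -> prog n A)
  | Draw of source & (bits n -> prog n A).

Arguments Ret {n A}.

Fixpoint bind (n : nat) A B (p : prog n A) (k : A -> prog n B) : prog n B :=
  match p with
  | Ret a => k a
  | Ask x c => Ask x (fun b => bind (c b) k)
  | Draw s c => Draw s (fun x => bind (c x) k)
  end.

Definition unif (n : nat) (x : bits n) : R := #|{: bits n}|%:R^-1.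

Definition law (n : nat) (D : bits n -> R) (s : source) : bits n -> R :=
  if s is Coins then @unif n else D.

Fixpoint ex (n : nat) (D : bits n -> R) (f : bits n -> bool) A (p : prog n A)
    (phi : A -> R) : R :=
  match p with
  | Ret a => phi a
  | Ask x c => ex D f (c (f x)) phi
  | Draw s c => \sum_x law D s x * ex D f (c x) phi
  end.

Definition pr (n : nat) (D : bits n -> R) (f : bits n -> bool)
  (p : prog n bool) : R := ex D f p (fun b : bool => b%:R).

(** All draws count here, even those of probability zero, but answers are the true values of [f].
    Completeness is argued with this notion, apart from the choice of the cells. *)
Fixpoint always (n : nat) (f : bits n -> bool) A (p : prog n A)
    (P : A -> Prop) : Prop :=
  match p with
  | Ret a => P a
  | Ask x c => always f (c (f x)) P
  | Draw s c => forall x, always f (c x) P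
  end.

Fixpoint qbound (n : nat) A (p : prog n A) (q : nat) : Prop :=
  match p with
  | Ret _ => True
  | Ask x c => if q is q'.+1 then forall b, qbound (c b) q' else False
  | Draw s c => forall x, qbound (c x) q
  end.

Section Programs.
Variables (n : nat).
Implicit Types (f : bits n -> bool) (D : bits n -> R).

Lemma card_bits_gt0 : (0 < #|{: bits n}|)%N.
Proof. by apply/card_gt0P; exists [ffun=> false]. Qed.

Lemma is_distr_unif : is_distr (@unif n).
Proof.
split=> [x|]; first by rewrite invr_ge0 ler0n.
rewrite /unif sumr_const -[LHS]mulr_natr mulVf // pnatr_eq0 -lt0n; exact: card_bits_gt0.
Qed.

Lemma is_distr_law D s : is_distr D -> is_distr (law D s).
Proof. by case: s => // _; exact: is_distr_unif. Qed.

Lemma ex_bind D f A B (p : prog n A) (k : A -> prog n B) phi :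
  ex D f (bind p k) phi = ex D f p (fun a => ex D f (k a) phi).
Proof.
elim: p => //= s c IH; by apply: eq_bigr => x _; rewrite IH.
Qed.

Lemma eq_ex D f A (p : prog n A) phi psi :
  phi =1 psi -> ex D f p phi = ex D f p psi.
Proof.
move=> E; elim: p => //= s c IH; by apply: eq_bigr => x _; rewrite IH.
Qed.

Lemma exD D f A (p : prog n A) phi psi :
  ex D f p (fun a => phi a + psi a) = ex D f p phi + ex D f p psi.
Proof.
elim: p => //= s c IH; rewrite -big_split /=.
by apply: eq_bigr => x _; rewrite IH mulrDr.
Qed.

Lemma ex_sum D f A I (r : seq I) (P : pred I) (p : prog n A) (phi : I -> A -> R) :
  ex D f p (fun a => \sum_(i <- r | P i) phi i a) = \sum_(i <- r | P i) ex D f p (phi i).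
Proof.
elim: p => //= s c IH; rewrite exchange_big /=.
by apply: eq_bigr => x _; rewrite IH mulr_sumr.
Qed.

Lemma exZr D f A (p : prog n A) phi c :
  ex D f p (fun a => phi a * c) = ex D f p phi * c.
Proof.
elim: p => //= s k IH; rewrite mulr_suml.
by apply: eq_bigr => x _; rewrite IH mulrA.
Qed.

Section Distr.
Variables (D : bits n -> R) (hD : is_distr D) (f : bits n -> bool).

Lemma law_ge0 s x : 0 <= law D s x.
Proof. by case: (is_distr_law s hD). Qed.

Lemma sum_law s : \sum_x law D s x = 1.
Proof. by case: (is_distr_law s hD). Qed.

Lemma ex_const A (p : prog n A) c : ex D f p (fun=> c) = c.
Proof.
elim: p => //= s k IH; under eq_bigr do rewrite IH.
by rewrite -mulr_suml sum_law mul1r.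
Qed.

Lemma ex_mono A (p : prog n A) phi psi :
  (forall a, phi a <= psi a) -> ex D f p phi <= ex D f p psi.
Proof.
move=> H; elim: p => //= s k IH; apply: ler_sum => x _.
by apply: ler_wpM2l (IH x); exact: law_ge0.
Qed.

Lemma ex_le A (p : prog n A) phi c : (forall a, phi a <= c) -> ex D f p phi <= c.
Proof. by move=> H; rewrite -[leRHS](ex_const p c); exact: ex_mono. Qed.

Lemma ex_ge A (p : prog n A) phi c : (forall a, c <= phi a) -> c <= ex D f p phi.
Proof. by move=> H; rewrite -[leLHS](ex_const p c); exact: ex_mono. Qed.

Lemma always_ex A (p : prog n A) P phi c :
  (forall a, P a -> c <= phi a) -> always f p P -> c <= ex D f p phi.
Proof.
move=> H; elim: p => /= [a|x k IH|s k IH] hp; [exact: H | exact: IH |].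
rewrite -[leLHS]mul1r -(sum_law s) mulr_suml.
by apply: ler_sum => x _; apply: ler_wpM2l; [exact: law_ge0 | exact: IH].
Qed.

Lemma pr_ge0 p : 0 <= pr D f p.
Proof. by apply: ex_ge => b; rewrite ler0n. Qed.

Lemma pr_le1 p : pr D f p <= 1.
Proof. by apply: ex_le => -[]. Qed.

Lemma ex_bool (p : prog n bool) phi :
  ex D f p phi = phi true * pr D f p + phi false * (1 - pr D f p).
Proof.
rewrite /pr -{1}(ex_const p 1).
transitivity (ex D f p
  (fun b : bool => b%:R * (phi true - phi false) + phi false)).
  by apply: eq_ex => -[] /=; ring.
by rewrite exD exZr !ex_const; ring.
Qed.

End Distr.

Lemma always_bind f A B (p : prog n A) (k : A -> prog n B) P Q :
  (forall a, P a -> always f (k a) Q) -> always f p P -> always f (bind p k) Q.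
Proof.
move=> H; elim: p => /= [a|x c IH|s c IH] hp; [exact: H | exact: IH |].
by move=> x; exact: IH.
Qed.

Lemma always_impl f A (p : prog n A) (P Q : A -> Prop) :
  (forall a, P a -> Q a) -> always f p P -> always f p Q.
Proof.
move=> H; elim: p => /= [a|x c IH|s c IH] hp; [exact: H | exact: IH |].
by move=> x; exact: IH.
Qed.

Lemma qboundW A (p : prog n A) q q' : (q <= q')%N -> qbound p q -> qbound p q'.
Proof.
elim: p q q' => //= [x c IH [//|q] [//|q'] le_q hc b|s c IH q q' le_q hc x].
  exact: IH (hc b).
exact: IH (hc x).
Qed.

Lemma qbound_bind A B (p : prog n A) (k : A -> prog n B) q r :
  qbound p q -> (forall a, qbound (k a) r) -> qbound (bind p k) (q + r).
Proof.
move=> hp hk; elim: p q hp => //= [a q _|x c IH [//|q] hc b|s c IH q hc x].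
- by apply: qboundW (hk a); rewrite leq_addl.
- exact: IH.
- exact: IH.
Qed.

(** * Conjunctions and independent repetitions of tests *)

Definition both (p q : prog n bool) : prog n bool :=
  bind p (fun b => if b then q else Ret false).

Fixpoint rep (m : nat) (p : prog n bool) : prog n bool :=
  if m is m'.+1 then both p (rep m' p) else Ret true.

Lemma pr_both D f p q : is_distr D -> pr D f (both p q) = pr D f p * pr D f q.
Proof. by move=> hD; rewrite /pr ex_bind ex_bool //= mul0r addr0 mulrC. Qed.

Lemma pr_rep D f m p : is_distr D -> pr D f (rep m p) = pr D f p ^+ m.
Proof.
by move=> hD; elim: m => //= m IH; rewrite pr_both // IH exprS.
Qed.

Lemma always_both f p q :
  always f p is_true -> always f q is_true -> always f (both p q) is_true.
Proof. by move=> hp hq; apply: always_bind hp => -[]. Qed.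

Lemma always_rep f m p : always f p is_true -> always f (rep m p) is_true.
Proof. by move=> hp; elim: m => //= m IH; exact: always_both. Qed.

Lemma qbound_both p q a b : qbound p a -> qbound q b -> qbound (both p q) (a + b).
Proof. by move=> hp hq; apply: qbound_bind => // -[]. Qed.

Lemma qbound_rep m p a : qbound p a -> qbound (rep m p) (m * a).
Proof. by move=> hp; elim: m => //= m IH; rewrite mulSn; exact: qbound_both. Qed.

(** * Compilation of programs into testers *)

Fixpoint qtree_of (p : prog n bool) (zs xs : seq (bits n)) : qtree n :=
  match p with
  | Ret b => Leaf n b
  | Ask x c => Query x (fun b => qtree_of (c b) zs xs)
  | Draw Coins c => if zs is z :: zs' then qtree_of (c z) zs' xs else Leaf n false
  | Draw Samples c => if xs is x :: xs' then qtree_of (c x) zs xs' else Leaf n false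
  end.

(** Both sources are counted together, so one number bounds the length needed for either list. With
    lists of at least this length, the default leaves of [qtree_of] are never reached. *)
Fixpoint ndraws (p : prog n bool) : nat :=
  match p with
  | Ret _ => 0
  | Ask x c => maxn (ndraws (c true)) (ndraws (c false))
  | Draw _ c => (\max_(x : bits n) ndraws (c x)).+1
  end.

Fixpoint exseq (mu : bits n -> R) (m : nat) (F : seq (bits n) -> R) : R :=
  if m is m'.+1 then \sum_x mu x * exseq mu m' (fun s => F (x :: s)) else F [::].

Lemma exseq_tuple mu m F :
  exseq mu m F = \sum_(t : m.-tuple (bits n)) (\prod_(i < m) mu (tnth t i)) * F t.
Proof.
elim: m F => [|m IH] F /=.
  rewrite (big_pred1 [tuple]) => [|t]; first by rewrite big_ord0 mul1r.
  by rewrite [t]tuple0 /=; apply/esym/eqP.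
under eq_bigr do rewrite IH mulr_sumr.
rewrite pair_big /=.
pose co (q : bits n * m.-tuple (bits n)) := [tuple of q.1 :: q.2].
rewrite [RHS](reindex co) /=; last first.
  exists (fun t => (thead t, [tuple of behead t])) => [[x t] _|t _] /=.
    by congr pair; apply: val_inj.
  by rewrite /co /= -tuple_eta.
apply: eq_bigr => -[x t] _ /=; rewrite big_ord_recl mulrA; congr (mu _ * _ * _).
by apply: eq_bigr => i _; rewrite /co tnthS.
Qed.

Lemma eq_exseq mu m F G : F =1 G -> exseq mu m F = exseq mu m G.
Proof.
elim: m F G => [|m IH] F G E /=; first exact: E.
by apply: eq_bigr => x _; congr (_ * _); apply: IH => s; exact: E.
Qed.

Lemma exseq_sum mu m (F : bits n -> seq (bits n) -> R) c :
  exseq mu m (fun s => \sum_x c x * F x s) = \sum_x c x * exseq mu m (F x).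
Proof.
elim: m F => [//|m IH] F /=.
under eq_bigr => y _ do rewrite IH mulr_sumr.
rewrite exchange_big /=; apply: eq_bigr => x _; rewrite mulr_sumr.
by apply: eq_bigr => y _; ring.
Qed.

Lemma exseq_const mu m c : is_distr mu -> exseq mu m (fun=> c) = c.
Proof.
move=> [_ h1]; elim: m => //= m IH; under eq_bigr do rewrite IH.
by rewrite -mulr_suml h1 mul1r.
Qed.

Lemma exseq_qtree_of D f p a b : is_distr D -> (ndraws p <= a)%N -> (ndraws p <= b)%N ->
  exseq (@unif n) a (fun zs => exseq D b (fun xs =>
    if (run (qtree_of p zs xs) f).1 then 1 else 0)) = pr D f p.
Proof.
move=> hD; rewrite /pr; elim: p a b => [v a b _ _|x c IH a b|[] c IH a b] /=.
- under eq_exseq do rewrite exseq_const //.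
  by rewrite exseq_const; [case: v | exact: is_distr_unif].
- rewrite !geq_max => /andP[ha ha'] /andP[hb hb']; apply: IH; by case: (f x).
- case: a => // a /[!ltnS] ha hb /=; apply: eq_bigr => z _; congr (_ * _).
  by apply: IH; apply: leq_trans (leq_bigmax (F := fun x => ndraws (c x)) z) _ => //;
    exact: ltnW.
- case: b => // b ha /[!ltnS] hb /=.
  rewrite exseq_sum; apply: eq_bigr => z _; congr (_ * _).
  by apply: IH; apply: leq_trans (leq_bigmax (F := fun x => ndraws (c x)) z) _ => //;
    exact: ltnW.
Qed.

Lemma qbound_run p zs xs f q : qbound p q -> ((run (qtree_of p zs xs) f).2 <= q)%N.
Proof.
elim: p zs xs q => //= [x c IH zs xs [//|q] hc|[] c IH [|z zs] [|x xs] q hc //=];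
  by apply: IH.
Qed.

(** The seed indexes an enumeration of tuples, so a uniform seed amounts to independent uniform
    points. The [.-1] offsets the successor in the type of seeds. *)
Definition tester_of (p : prog n bool) : tester n :=
  @Tester n #|{: (ndraws p).-tuple (bits n)}|.-1 (ndraws p)
    (fun s xs => qtree_of p (nth [tuple of nseq _ [ffun=> false]]
       (enum {: (ndraws p).-tuple (bits n)}) s) xs).

Lemma acc_prob_tester_of p D f : is_distr D -> acc_prob (tester_of p) D f = pr D f p.
Proof.
move=> hD; rewrite -(@exseq_qtree_of _ _ _ (ndraws p) (ndraws p)) // exseq_tuple.
rewrite /acc_prob /=; set d := ndraws p.
have cT : (#|{: d.-tuple (bits n)}|.-1.+1 = #|{: d.-tuple (bits n)}|)%N.
  by rewrite prednK // card_tuple expn_gt0 card_bits_gt0.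
rewrite (reindex (fun t : d.-tuple (bits n) => cast_ord (esym cT) (enum_rank t))) /=; last first.
  exists (fun s => enum_val (cast_ord cT s)) => [t _|s _].
    by rewrite cast_ordKV enum_rankK.
  by rewrite enum_valK cast_ordK.
apply: eq_bigr => t _; rewrite nth_enum_rank exseq_tuple mulr_sumr.
apply: eq_bigr => xs _; rewrite mulrA; congr (_ * _ * _).
by rewrite cT card_tuple prodr_const card_ord natrX exprVn.
Qed.

End Programs.

(** * Self-correction of dictators *)

Definition bzero (n : nat) : bits n := [ffun=> false].
Definition bunit (n : nat) (i : 'I_n) : bits n := [ffun j => j == i].
Definition bxor (n : nat) (x y : bits n) : bits n := [ffun i => x i (+) y i].
Definition band (n : nat) (x y : bits n) : bits n := [ffun i => x i && y i].
Definition mean (n : nat) (F : bits n -> R) : R := \sum_z unif z * F z.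

Section Dictators.
Variable n : nat.
Implicit Types (x y z u w : bits n) (F G : bits n -> R).

Lemma bxorC x y : bxor x y = bxor y x.
Proof. by apply/ffunP=> i; rewrite !ffunE addbC. Qed.

Lemma bxorA x y z : bxor x (bxor y z) = bxor (bxor x y) z.
Proof. by apply/ffunP=> i; rewrite !ffunE addbA. Qed.

Lemma bxorK x : involutive (bxor x).
Proof. by move=> y; apply/ffunP=> i; rewrite !ffunE addKb. Qed.

Lemma bxorxx x : bxor x x = bzero n.
Proof. by apply/ffunP=> i; rewrite !ffunE addbb. Qed.

Lemma mean_const c : mean (fun _ : bits n => c) = c.
Proof. by have [_ h] := is_distr_unif n; rewrite /mean -mulr_suml h mul1r. Qed.

Lemma meanD F G : mean (fun z => F z + G z) = mean F + mean G.
Proof. by rewrite /mean -big_split; apply: eq_bigr => z _; rewrite mulrDr. Qed.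

Lemma meanZ F c : mean (fun z => c * F z) = c * mean F.
Proof. by rewrite /mean mulr_sumr; apply: eq_bigr => z _; rewrite mulrCA. Qed.

Lemma eq_mean F G : F =1 G -> mean F = mean G.
Proof. by move=> E; apply: eq_bigr => z _; rewrite E. Qed.

Lemma mean_mono F G : (forall z, F z <= G z) -> mean F <= mean G.
Proof.
move=> H; apply: ler_sum => z _; apply: ler_wpM2l (H z).
by have [h _] := is_distr_unif n.
Qed.

Lemma mean_ge F c : (forall z, c <= F z) -> c <= mean F.
Proof. by move=> H; rewrite -[c]mean_const; exact: mean_mono. Qed.

Lemma mean_le F c : (forall z, F z <= c) -> mean F <= c.
Proof. by move=> H; rewrite -[c]mean_const; exact: mean_mono. Qed.

Lemma mean_shift a F : mean (fun z => F (bxor a z)) = mean F.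
Proof.
rewrite /mean [RHS](reindex (bxor a)) //; exists (bxor a) => z _; exact: bxorK.
Qed.

Lemma mean_negb (B : bits n -> bool) :
  mean (fun z => (~~ B z)%:R) = 1 - mean (fun z => (B z)%:R).
Proof.
rewrite -[X in X - _](mean_const 1) -[- mean _]mulN1r -meanZ -meanD.
by apply: eq_mean => z; case: (B z) => /=; ring.
Qed.

Section Decoding.
Variable h : bits n -> bool.

(** The Blum-Luby-Rubinfeld linearity defect; the term at [bzero n] lets negated coordinates pass as
    well. *)
Definition affine_defect u w : bool := h u (+) h w (+) h (bxor u w) (+) h (bzero n).
Definition shifted_diff y z : bool := h (bxor y z) (+) h z.
Definition decoded y : bool := 1 / 2 < mean (fun z => (shifted_diff y z)%:R).

Hypothesis small_defect :
  mean (fun u => mean (fun w => (affine_defect u w)%:R)) <= 1 / 32.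

(** The sum of the two differences equals the defect at [(y + z, w)] plus the defect at
    [(z, y + w)]. By shift invariance each has mean at most 1/32. *)
Lemma shifted_diff_collision y :
  mean (fun z => mean (fun w => (shifted_diff y z (+) shifted_diff y w)%:R)) <= 1 / 16.
Proof.
apply: le_trans (_ : mean (fun z => mean (fun w =>
  (affine_defect (bxor y z) w)%:R + (affine_defect z (bxor y w))%:R)) <= _).
  apply: mean_mono => z; apply: mean_mono => w; rewrite /affine_defect /shifted_diff.
  rewrite bxorA (bxorC z y).
  by do 6!case: (h _); rewrite /=; lra.
under eq_mean do rewrite meanD.
rewrite meanD (mean_shift y (fun u => mean (fun w => (affine_defect u w)%:R))).
have -> : mean (fun z => mean (fun w => (affine_defect z (bxor y w))%:R)) =
          mean (fun u => mean (fun w => (affine_defect u w)%:R)).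
  apply: eq_mean => u; exact: (mean_shift y (fun w => (affine_defect u w)%:R)).
move: small_defect; lra.
Qed.

(** If [p] is the probability that the difference is 1, two independent votes differ with
    probability [2p(1-p)], which is at least the minority mass [min(p, 1-p)]. *)
Lemma decoded_err y :
  mean (fun z => (shifted_diff y z != decoded y)%:R) <= 1 / 16.
Proof.
set p := mean (fun z => (shifted_diff y z)%:R).
have p0 : 0 <= p by apply: mean_ge => z; exact: ler0n.
have p1 : p <= 1 by apply: mean_le => z; case: (shifted_diff y z).
have pp : 2 * (p * (1 - p)) <= 1 / 16.
  apply: le_trans (shifted_diff_collision y); rewrite le_eqVlt; apply/orP; left; apply/eqP.
  transitivity (mean (fun z => p + (1 - 2 * p) * (shifted_diff y z)%:R)).
    by rewrite meanD mean_const meanZ -/p; ring.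
  apply: eq_mean => z; case: (shifted_diff y z).
    rewrite [RHS](eq_mean (G := fun w => (~~ shifted_diff y w)%:R)) //.
    by rewrite mean_negb -/p /=; ring.
  by rewrite -[RHS]/p /=; ring.
rewrite /decoded -/p; case: ltrP => hp.
  rewrite (eq_mean (G := fun w => (~~ shifted_diff y w)%:R)) => [|w].
    by rewrite mean_negb -/p; nra.
  by case: shifted_diff.
rewrite (eq_mean (G := fun w => (shifted_diff y w)%:R)) => [|w].
  by rewrite -/p; nra.
by case: shifted_diff.
Qed.

(** The differences telescope: the one for [a] at [z] plus the one for [b] at [a + z] is the one for
    [a + b] at [z]. If additivity failed, one of three votes would be wrong at every [z], yet the
    error rates sum to at most 3/16. *)
Lemma decoded_additive a b : decoded (bxor a b) = decoded a (+) decoded b.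
Proof.
apply/eqP/contraT => H.
suff : (1 : R) <= 1 / 16 + (1 / 16 + 1 / 16) by lra.
apply: le_trans (lerD (decoded_err a) (lerD (decoded_err b) (decoded_err (bxor a b)))).
rewrite -(mean_shift a (fun z => (shifted_diff b z != _)%:R)) -!meanD.
apply: mean_ge => z; rewrite /shifted_diff bxorA (bxorC b a).
by move: H; do 3!case: (decoded _); do 3!case: (h _); rewrite //= => _; lra.
Qed.

Lemma decoded0 : decoded (bzero n) = false.
Proof. by rewrite -(bxorxx (bzero n)) decoded_additive addbb. Qed.

Lemma decoded_eq0 y : (forall i, y i -> ~~ decoded (bunit i)) -> ~~ decoded y.
Proof.
have [m] := ubnP #|[set i | y i]|; elim: m y => // m IH y le_m hy.
have [i yi|y0] := pickP (fun i => y i); last first.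
  suff -> : y = bzero n by rewrite decoded0.
  by apply/ffunP=> i; rewrite ffunE y0.
rewrite -(bxorK (bunit i) y) decoded_additive (negPf (hy i yi)) /=; apply: IH.
  rewrite -ltnS; apply: leq_trans le_m; rewrite ltnS; apply: proper_card.
  apply/properP; split; last by exists i; rewrite !inE // !ffunE eqxx yi.
  apply/subsetP=> j; rewrite !inE !ffunE; by case: eqP => // ->.
move=> j; rewrite !ffunE; case: eqP => [->|_]; [by rewrite yi | exact: hy].
Qed.

(** Among linear forms over the two-element field, exactly the coordinates and 0 are
    multiplicative. *)
Definition mult_defect u w : bool := decoded (band u w) (+) (decoded u && decoded w).

(* The second difference of the defect in the directions [bunit i], [bunit j] is constantly 1. *)
Lemma mult_defect_ge (i j : 'I_n) : i != j -> decoded (bunit i) -> decoded (bunit j) ->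
  1 / 4 <= mean (fun u => mean (fun w => (mult_defect u w)%:R)).
Proof.
move=> ij di dj; pose M u := mean (fun w => (mult_defect u w)%:R).
have Mj u : M u = mean (fun w => (mult_defect u (bxor (bunit j) w))%:R).
  by rewrite (mean_shift (bunit j) (fun w => (mult_defect u w)%:R)).
have Mi : mean M = mean (fun u => M (bxor (bunit i) u)) by rewrite (mean_shift (bunit i) M).
(* The four copies of [mean M] are taken with [u] shifted by [bunit i] or not and [w] by [bunit j]
   or not. At every point the four defects sum to 1 modulo 2, so at least one of them is 1. *)
suff: 1 <= 2 * mean M + 2 * mean M by rewrite -/M; lra.
rewrite {2}Mi -!meanZ -meanD; apply: mean_ge => u.
have -> : 2 * M u + 2 * M (bxor (bunit i) u) =
   (M u + M u) + (M (bxor (bunit i) u) + M (bxor (bunit i) u)) by ring.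
rewrite {2}(Mj u) {2}(Mj (bxor _ u)) -!meanD; apply: mean_ge => w.
have andE (a b : bits n) (l : 'I_n) :
    decoded (band (bxor (bunit l) a) b) = (b l && decoded (bunit l)) (+) decoded (band a b).
  have -> : band (bxor (bunit l) a) b =
      bxor (if b l then bunit l else bzero n) (band a b).
    apply/ffunP=> s; rewrite !ffunE; case: (eqVneq s l) => [->|sl].
      by case: (b l); rewrite !ffunE ?eqxx /= ?andbT ?andbF //; case: (a l).
    by case: (b l); rewrite !ffunE ?(negPf sl).
  by rewrite decoded_additive; case: (b l); rewrite ?decoded0.
have bandC (a b : bits n) : band a b = band b a.
  by apply/ffunP=> s; rewrite !ffunE andbC.
rewrite /mult_defect !andE !(bandC _ (bxor _ w)) !andE !decoded_additive di dj.
rewrite !(bandC w) !ffunE (negPf ij) /=.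
by do 3!case: (decoded _); case: (u j); case: (w i); rewrite /=; lra.
Qed.

End Decoding.
End Dictators.

(** * The tester and its soundness *)

Definition mix (n : nat) (Z : {set 'I_n}) (y v : bits n) : bits n :=
  [ffun i => if i \in Z then y i else v i].

(* A block [(Z, v)] stands for the restriction [y |-> f (mix Z y v)] of [f]. *)
Definition block (n : nat) : Type := ({set 'I_n} * bits n)%type.

Section Algorithm.
Variable n : nat.
Implicit Types (x y v : bits n) (Z X : {set 'I_n}) (e : block n) (st : seq (block n)).

Definition slice (f : bits n -> bool) e y : bool := f (mix e.1 y e.2).

Definition decode e y : prog n bool :=
  Draw Coins (fun z =>
  Ask (mix e.1 (bxor y z) e.2) (fun a => Ask (mix e.1 z e.2) (fun b => Ret (a (+) b)))).

Definition affine_test e : prog n bool :=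
  Draw Coins (fun u => Draw Coins (fun w =>
  Ask (mix e.1 u e.2) (fun a => Ask (mix e.1 w e.2) (fun b =>
  Ask (mix e.1 (bxor u w) e.2) (fun c => Ask (mix e.1 (bzero n) e.2) (fun d =>
  Ret (~~ (a (+) b (+) c (+) d)))))))).

Definition mult_test e : prog n bool :=
  Draw Coins (fun u => Draw Coins (fun w =>
  bind (decode e u) (fun a => bind (decode e w) (fun b =>
  bind (decode e (band u w)) (fun c => Ret (c == a && b)))))).

Definition dictator_test e : prog n bool := both (affine_test e) (mult_test e).

(** Here 320 is 10 times 32: a block whose test passes with probability at most 31/32 survives all
    repetitions with probability at most 1/11. *)
Definition dictator_tests st : prog n bool :=
  foldr (fun e p => both (rep 320 (dictator_test e)) p) (Ret true) st.

(** The [m] further decodings must confirm the first one, which makes the chance of proceeding with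
    a wrong bit exponentially small in [m]. *)
Fixpoint spread_check (m : nat) st x y (t : bool) : prog n bool :=
  if st is e :: st' then
    bind (decode e x) (fun b =>
    both (rep m (bind (decode e x) (fun c => Ret (c == b))))
         (spread_check m st' x (mix e.1 [ffun=> b] y) t))
  else Ask y (fun b => Ret (b == t)).

Definition supp st : {set 'I_n} := \bigcup_(e <- st) e.1.

Definition cut X x : bits n := mix X x (bzero n).

Definition consistency_test (m : nat) st : prog n bool :=
  Draw Samples (fun x => Ask (cut (supp st) x) (fun t =>
  spread_check m st x (bzero n) t)).

Definition verify (T m : nat) st : prog n bool :=
  both (dictator_tests st) (rep T (consistency_test m st)).

Fixpoint scan (L : nat) X : prog n (option (bits n * bool)) :=
  if L is L'.+1 then
    Draw Samples (fun x => Ask x (fun a => Ask (cut X x) (fun b =>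
    if a == b then scan L' X else Ret (Some (x, a)))))
  else Ret None.

(* Binary search for a cell: [f a = fa], [f b <> fa], and [a], [b] agree off [Z]. *)
Fixpoint search (ss : seq (bits n)) Z (a b : bits n) (fa : bool) : prog n (block n) :=
  if ss is s :: ss' then
    let Z1 := [set i in Z | s i] in
    let c := mix Z1 b a in
    Ask c (fun fc => if fc != fa then search ss' Z1 a c fa
                     else search ss' (Z :\: Z1) c b fa)
  else Ret (Z, a).

Fixpoint explore (L T m : nat) (ss : seq (bits n)) (fuel : nat) st : prog n bool :=
  bind (scan L (supp st)) (fun o =>
  if o is Some (x, fx) then
    bind (search ss (~: supp st) x (cut (supp st) x) fx) (fun e =>
    if fuel is fuel'.+1 then explore L T m ss fuel' (e :: st) else Ret false)
  else verify T m st).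

Lemma exploreE (L T m : nat) ss fuel st : explore L T m ss fuel st =
  bind (scan L (supp st)) (fun o =>
  if o is Some (x, fx) then
    bind (search ss (~: supp st) x (cut (supp st) x) fx) (fun e =>
    if fuel is fuel'.+1 then explore L T m ss fuel' (e :: st) else Ret false)
  else verify T m st).
Proof. by case: fuel. Qed.

Fixpoint coins (p : nat) : prog n (p.-tuple (bits n)) :=
  if p is p'.+1 then
    Draw Coins (fun z => bind (coins p') (fun s => Ret [tuple of z :: s]))
  else Ret [tuple].

(** The bits of a coordinate in the [p] random points are the label of its cell, so there are at
    most [2 ^ p] cells. The fuel [k] is the number of blocks allowed before rejection. *)
Definition junta_test (L T m p k : nat) : prog n bool :=
  bind (coins p) (fun ss => explore L T m ss k [::]).

(** * Soundness: functions far from every junta are rejected *)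

Section Soundness.
Variables (D : bits n -> R) (hD : is_distr D) (f : bits n -> bool).

(** [Some i] stands for the coordinate [i] and [None] for the zero form. The error bound holds at
    every [y], not just on average, so samples from an arbitrary [D] can be decoded. *)
Definition decodable e (o : option 'I_n) : Prop := forall y,
  mean (fun z => (shifted_diff (slice f e) y z != oapp (fun i => y i) false o)%:R) <= 1 / 16.

Lemma ex_decode_le e y phi b d : (forall c, 0 <= phi c <= 1) ->
  mean (fun z => (shifted_diff (slice f e) y z != b)%:R) <= d ->
  ex D f (decode e y) phi <= phi b + d.
Proof.
move=> hphi hd; apply: le_trans (_ : phi b + mean (fun z =>
  (shifted_diff (slice f e) y z != b)%:R) <= _); last by rewrite lerD2l.
rewrite -[phi b](mean_const n) -meanD; apply: mean_mono => z /=.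
rewrite -[f (mix _ (bxor y z) _)]/(slice f e _) -[f (mix _ z _)]/(slice f e _).
rewrite -/(shifted_diff (slice f e) y z).
have /andP[h0 h1] := hphi b; have /andP[] := hphi (shifted_diff (slice f e) y z).
by case: eqP => [->|_] /=; lra.
Qed.

Lemma pr_affine_test e : pr D f (affine_test e) =
  1 - mean (fun u => mean (fun w => (affine_defect (slice f e) u w)%:R)).
Proof.
rewrite -[X in X - _](mean_const n 1) -[- mean _]mulN1r -meanZ -meanD.
by apply: eq_mean => u; rewrite mulN1r -mean_negb.
Qed.

(** Each of the three decodings deviates from the majority value with probability at most 1/16,
    whence the slack 3/16. *)
Lemma pr_mult_test_le e :
  mean (fun u => mean (fun w => (affine_defect (slice f e) u w)%:R)) <= 1 / 32 ->
  pr D f (mult_test e) <=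
    1 - mean (fun u => mean (fun w => (mult_defect (slice f e) u w)%:R)) + 3 / 16.
Proof.
move=> hs; have err := decoded_err hs.
have -> : 1 - mean (fun u => mean (fun w => (mult_defect (slice f e) u w)%:R)) + 3 / 16 =
  mean (fun u => mean (fun w => 19 / 16 + (-1) * (mult_defect (slice f e) u w)%:R)).
  under [RHS]eq_mean do rewrite meanD mean_const meanZ.
  by rewrite meanD mean_const meanZ; lra.
apply: mean_mono => u; apply: mean_mono => w.
rewrite -[leLHS]/(ex D f (bind (decode e u) (fun a => bind (decode e w) (fun b =>
  bind (decode e (band u w)) (fun c => Ret (c == a && b))))) (fun b : bool => b%:R)).
have b01 p c : 0 <= ex D f (p c) (fun b : bool => b%:R) <= 1.
  by rewrite pr_ge0 // pr_le1.
rewrite ex_bind; apply: le_trans (ex_decode_le _ (err u)) _ => [a|]; first exact: b01.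
rewrite ex_bind; apply: le_trans (lerD (ex_decode_le _ (err w)) (lexx _)) _ => [a|].
  exact: b01.
rewrite ex_bind.
apply: le_trans (lerD (lerD (ex_decode_le _ (err (band u w))) (lexx _)) (lexx _)) _ => [a|].
  exact: b01.
rewrite /mult_defect /=; case: (decoded _ (band u w)); case: (_ && _) => /=; lra.
Qed.

(** The affinity test makes [decoded] linear. The multiplicativity test leaves a defect below 1/32 +
    3/16 = 7/32, less than the 1/4 forced by two unit vectors decoded to 1, so at most one is. *)
Lemma dictator_test_decodable e : 31 / 32 < pr D f (dictator_test e) ->
  exists o, decodable e o.
Proof.
rewrite pr_both // => hp.
have [a0 a1] := (pr_ge0 hD f (affine_test e), pr_le1 hD f (affine_test e)).
have [m0 m1] := (pr_ge0 hD f (mult_test e), pr_le1 hD f (mult_test e)).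
have ha : 31 / 32 < pr D f (affine_test e) by nra.
have hm : 31 / 32 < pr D f (mult_test e) by nra.
have hs : mean (fun u => mean (fun w => (affine_defect (slice f e) u w)%:R)) <= 1 / 32.
  by move: ha; rewrite pr_affine_test; lra.
have err := decoded_err hs; have add := decoded_additive hs.
have uniq_i i j : decoded (slice f e) (bunit i) -> decoded (slice f e) (bunit j) -> i = j.
  move=> di dj; apply/eqP/contraT => /(mult_defect_ge hs)/(_ di dj).
  by move: (pr_mult_test_le hs); lra.
have [i di|no] := pickP (fun i => decoded (slice f e) (bunit i)); last first.
  exists None => y; have /negPf <- : ~~ decoded (slice f e) y; last exact: err.
  by apply: decoded_eq0 => // i _; rewrite no.
exists (Some i) => y /=; suff <- : decoded (slice f e) y = y i by exact: err.
have off (z : bits n) : z i = false -> decoded (slice f e) z = false.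
  move=> zi; apply/negbTE/decoded_eq0 => // j zj; apply/negP => dj.
  by move: zj; rewrite -(uniq_i i j) ?zi.
case yi: (y i); last exact: off.
by rewrite -(bxorK (bunit i) y) add di off // !ffunE eqxx yi.
Qed.

Lemma pr_spread_check_cons m e st x y t :
  pr D f (spread_check m (e :: st) x y t) = ex D f (decode e x) (fun b =>
    pr D f (bind (decode e x) (fun c => Ret (c == b))) ^+ m *
    pr D f (spread_check m st x (mix e.1 [ffun=> b] y) t)).
Proof.
etransitivity; first exact: (ex_bind D f (decode e x)).
by apply: eq_ex => b; rewrite -/(pr _ _ _) pr_both // pr_rep.
Qed.

(** [S] collects the decoded coordinates, and [G] copies their bits over the blocks. If the first
    decoding of a block is right, the induction continues; if it is wrong, all [m] confirmations
    must be wrong too. *)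
Lemma spread_check_sound m st : (forall e, e \in st -> exists o, decodable e o) ->
  exists (G : bits n -> bits n -> bits n) (S : {set 'I_n}), [/\ (#|S| <= size st)%N,
    forall x x' y, (forall i, i \in S -> x i = x' i) -> G x y = G x' y &
    forall x y t, f (G x y) != t ->
      pr D f (spread_check m st x y t) <= (size st)%:R * (1 / 16) ^+ m].
Proof.
elim: st => [|e st IH] hst.
  exists (fun _ y => y), set0; split=> [|//|x y t /negPf E]; first by rewrite cards0.
  by rewrite /pr /= E mul0r.
have [|G [S [cS hG hpr]]] := IH; first by move=> e' he'; apply: hst; rewrite inE he' orbT.
have [o ho] := hst e (mem_head _ _).
pose g x := oapp (fun i : 'I_n => x i) false o.
exists (fun x y => G x (mix e.1 [ffun=> g x] y)), (oapp (fun i => i |: S) S o); split.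
- rewrite /=; case: (o) => [i|] /=; last exact: leqW.
  by rewrite cardsU1 -add1n; apply: leq_add => //; case: (_ \notin _).
- move=> x x' y hxx; have -> : g x = g x'.
    by rewrite /g; case: (o) hxx => //= i; apply; rewrite inE set11.
  apply: hG => i iS; apply: hxx; by case: (o) => //= j; rewrite inE iS orbT.
move=> x y t hf; rewrite pr_spread_check_cons; apply: ex_le => // b.
set q := pr _ _ (bind _ _); set c := pr _ _ (spread_check _ _ _ _ _).
have q0 : 0 <= q by exact: pr_ge0.
have d0 : 0 <= (1 / 16 : R) ^+ m by apply: exprn_ge0; lra.
set d := (1 / 16) ^+ m in d0 hpr *.
rewrite [size _]/= -natr1 mulrDl mul1r.
have [bg|bg] := eqVneq b (g x).
  apply: le_trans (_ : 1 * ((size st)%:R * d) <= _); last by rewrite mul1r lerDl.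
  apply: ler_pM; [exact: exprn_ge0 | exact: pr_ge0 | | ].
    by apply: exprn_ile1 => //; exact: pr_le1.
  by apply: hpr; rewrite bg.
have qle : q <= 1 / 16.
  rewrite /q /pr ex_bind; apply: le_trans (ex_decode_le _ (ho x)) _ => [a|].
    by rewrite /= ler0n lern1 leq_b1.
  by rewrite /= eq_sym (negPf bg) add0r.
apply: le_trans (_ : d * 1 <= _); last first.
  by rewrite mulr1 lerDr mulr_ge0.
apply: ler_pM; [exact: exprn_ge0 | exact: pr_ge0 | | exact: pr_le1].
by apply: lerXn2r; rewrite // nnegrE; lra.
Qed.

Lemma pr_dictator_tests_le st e : e \in st ->
  pr D f (dictator_tests st) <= pr D f (dictator_test e) ^+ 320.
Proof.
elim: st => // e' st IH; rewrite inE.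
rewrite -[dictator_tests _]/(both (rep 320 (dictator_test e')) (dictator_tests st)).
rewrite pr_both // pr_rep // => /predU1P[->|he].
  by apply: ler_piMr; [apply: exprn_ge0; exact: pr_ge0 | exact: pr_le1].
apply: le_trans (IH he); apply: ler_piMl; first exact: pr_ge0.
by apply: exprn_ile1; [exact: pr_ge0 | exact: pr_le1].
Qed.

(** A Bernoulli-type substitute for exponential bounds; the induction step is
    [(1 - a)(1 + (N + 1)a) <= 1 + Na]. *)
Lemma expr_decay (x a : R) N : 0 <= a -> 0 <= x -> x <= 1 - a ->
  x ^+ N * (1 + N%:R * a) <= 1.
Proof.
move=> a0 x0 xa; elim: N => [|N IH]; first by rewrite expr0 mul0r addr0 mulr1.
apply: le_trans IH; rewrite exprSr -mulrA; apply: ler_wpM2l; first exact: exprn_ge0.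
rewrite -natr1; have N0 : 0 <= N%:R :> R by exact: ler0n.
move: (N%:R) N0 => r r0.
apply: le_trans (_ : (1 - a) * (1 + (r + 1) * a) <= _); last by nra.
by apply: ler_wpM2r => //; nra.
Qed.

Lemma pr_scan_None L X :
  ex D f (scan L X) (fun o => (~~ isSome o)%:R) = (1 - distD D f (f \o cut X)) ^+ L.
Proof.
elim: L => //= L IH; rewrite exprS -IH; set E := ex _ _ _ _.
rewrite mulrBl mul1r /distD mulr_suml [X in _ - X]big_mkcond /=.
have [_ D1] := hD; rewrite -[X in X - _]mul1r -[X in X * _ - _]D1 mulr_suml.
rewrite -sumrN -big_split /=; apply: eq_bigr => x _.
case: eqP => _ /=; rewrite -/E; lra.
Qed.

Lemma distD_triangle (g g' g'' : bits n -> bool) :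
  distD D g g'' <= distD D g g' + distD D g' g''.
Proof.
rewrite /distD (big_mkcond (fun x => g x != g'' x)) (big_mkcond (fun x => g x != g' x)).
rewrite (big_mkcond (fun x => g' x != g'' x)) -big_split; apply: ler_sum => x _ /=.
have [/(_ x) Dx _] := hD.
by case: (g x) (g' x) (g'' x) => -[] [] /=; lra.
Qed.

Variables (k : nat) (eps : R).
Hypotheses (eps0 : 0 < eps) (eps1 : eps <= 1) (hfar : far_from_juntas k eps D f).
Variables (L T m : nat) (eta : R).
Hypotheses (hT : 10 <= T%:R * (eps / 4)) (hm : k%:R * (1 / 16) ^+ m <= 1 / 2 :> R).
Hypothesis hL : forall x : R, 0 <= x -> x <= 1 - eps / 2 -> x ^+ L <= eta.

(** The function [g] read off from the decoded coordinates is a [k]-junta, so by the triangle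
    inequality it disagrees with [f \o cut (supp st)] on mass at least [eps / 2]. There the check
    passes with probability at most 1/2. *)
Lemma consistency_test_sound st : (size st <= k)%N ->
  (forall e, e \in st -> exists o, decodable e o) ->
  distD D f (f \o cut (supp st)) < eps / 2 ->
  pr D f (consistency_test m st) <= 1 - eps / 4.
Proof.
move=> hk hst hd; have [G [S [cS hG hpr]]] := spread_check_sound m hst.
pose g x := f (G x (bzero n)).
have gj : is_junta k g.
  exists S; split=> [|x y hxy]; [exact: leq_trans hk | by rewrite /g (hG _ _ _ hxy)].
have d2 : eps / 2 <= distD D (f \o cut (supp st)) g.
  by have := hfar gj; have := distD_triangle f (f \o cut (supp st)) g; lra.
apply: le_trans (_ : 1 - distD D (f \o cut (supp st)) g / 2 <= _); last by lra.
rewrite /distD mulr_suml big_mkcond /=; have [D0 D1] := hD; rewrite -[X in _ <= X - _]D1.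
rewrite -sumrN -big_split /=; apply: ler_sum => x _.
rewrite -[leLHS]/(D x * pr D f (spread_check m st x (bzero n) (f (cut (supp st) x)))).
have [E|ne] := eqVneq.
  rewrite subr0; apply: ler_piMr (D0 x) _; exact: pr_le1.
have : pr D f (spread_check m st x (bzero n) (f (cut (supp st) x))) <= 1 / 2.
  apply: le_trans (hpr _ _ _ _) _; first by rewrite eq_sym.
  apply: le_trans hm; apply: ler_wpM2r; first by apply: exprn_ge0; lra.
  by rewrite ler_nat.
by move/(ler_wpM2l (D0 x)); rewrite /=; lra.
Qed.

(** Either all blocks are decodable and the consistency tests catch [f], or some block is caught by
    its dictator tests. In both cases [expr_decay] is applied with [Na >= 10], which gives 1/11. *)
Lemma verify_sound st : (size st <= k)%N ->
  distD D f (f \o cut (supp st)) < eps / 2 -> pr D f (verify T m st) <= 1 / 11.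
Proof.
move=> hk hd; rewrite pr_both // pr_rep //.
have [d0 d1] := (pr_ge0 hD f (dictator_tests st), pr_le1 hD f (dictator_tests st)).
have c0 := pr_ge0 hD f (consistency_test m st).
have c1 := pr_le1 hD f (consistency_test m st).
have [/allP good|/allPn[e he]] := boolP (all (fun e => 31 / 32 < pr D f (dictator_test e)) st).
  have cle : pr D f (consistency_test m st) <= 1 - eps / 4.
    apply: consistency_test_sound => // e /good; exact: dictator_test_decodable.
  apply: le_trans (ler_piMl _ d1) _; first exact: exprn_ge0.
  have e4 : 0 <= eps / 4 by move: eps0; lra.
  have := expr_decay T e4 c0 cle; have := exprn_ge0 T c0.
  by move: (_ ^+ T) => r r0 hr; have := ler_wpM2l r0 hT; lra.
rewrite -leNgt => hle; apply: le_trans (ler_piMr d0 (exprn_ile1 T c0 c1)) _.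
apply: le_trans (pr_dictator_tests_le he) _.
have hle' : pr D f (dictator_test e) <= 1 - 1 / 32 by lra.
have := expr_decay 320 _ (pr_ge0 hD f (dictator_test e)) hle'.
by move: (_ ^+ 320) => r; lra.
Qed.

Lemma eta_ge0 : 0 <= eta.
Proof.
by apply: le_trans (hL (x := 1 - eps / 2) _ _); [apply: exprn_ge0 | | ]; move: eps1; lra.
Qed.

(** If [f] is far from [f \o cut X], the scan misses this with probability at most [eta]; otherwise
    the bound [c] applies to [None] as well. *)
Lemma scan_sound X (phi : option (bits n * bool) -> R) c :
  (forall xb, phi (Some xb) <= c) -> 0 <= c -> phi None <= 1 ->
  (distD D f (f \o cut X) < eps / 2 -> phi None <= c) ->
  ex D f (scan L X) phi <= eta + c.
Proof.
move=> hS c0 hN1 hN.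
have eta0 := eta_ge0.
have [/hN {}hN|hd] := ltrP (distD D f (f \o cut X)) (eps / 2).
  by apply: ex_le => // -[xb|]; [move: (hS xb) | ]; lra.
apply: le_trans (_ : ex D f (scan L X) (fun o => (~~ isSome o)%:R + c) <= _).
  by apply: ex_mono => // -[xb|] /=; [move: (hS xb) | ]; lra.
rewrite exD ex_const // pr_scan_None lerD2r; apply: hL; last by lra.
rewrite subr_ge0 /distD; have [D0 <-] := hD.
by rewrite [leRHS](bigID (fun x => f x != (f \o cut X) x)) /= lerDl sumr_ge0.
Qed.

Lemma pr_explore ss fuel st : pr D f (explore L T m ss fuel st) =
  ex D f (scan L (supp st)) (fun o => if o is Some (x, fx) then
    ex D f (search ss (~: supp st) x (cut (supp st) x) fx) (fun e =>
      if fuel is fuel'.+1 then pr D f (explore L T m ss fuel' (e :: st)) else 0)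
    else pr D f (verify T m st)).
Proof.
rewrite /pr exploreE ex_bind; apply: eq_ex => -[[x fx]|] //; rewrite ex_bind.
by apply: eq_ex => e; case: fuel.
Qed.

(** A union bound: each of the at most [fuel.+1] scans costs [eta], and verification happens at most
    once. *)
Lemma explore_sound ss fuel st : (size st + fuel <= k)%N ->
  pr D f (explore L T m ss fuel st) <= fuel.+1%:R * eta + 1 / 11.
Proof.
elim: fuel st => [|fuel IH] st hk; rewrite pr_explore.
  rewrite [_ * eta]mul1r; apply: scan_sound => [[x b]|||]; [|lra|exact: pr_le1|].
    by apply: ex_le => // e; lra.
  by apply: verify_sound; move: hk; rewrite addn0.
rewrite -[fuel.+2%:R]natr1 mulrDl [1 * eta]mul1r [_ + eta]addrC -addrA.
have F0 : 0 <= fuel.+1%:R * eta by apply: mulr_ge0 => //; exact: eta_ge0.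
apply: scan_sound => [[x b]|||hd]; [|lra|exact: pr_le1|].
  apply: ex_le => // e.
  by apply: IH; rewrite [size _]/= addSnnS.
have : pr D f (verify T m st) <= 1 / 11.
  by apply: verify_sound => //; apply: leq_trans hk; rewrite leq_addr.
by lra.
Qed.

Lemma junta_test_sound p :
  pr D f (junta_test L T m p k) <= k.+1%:R * eta + 1 / 11.
Proof. by rewrite /pr ex_bind; apply: ex_le => // ss; exact: explore_sound. Qed.

End Soundness.
End Algorithm.

(** * Completeness *)

Section Completeness.
Variables (n : nat) (f : bits n -> bool) (S : {set 'I_n}).
Hypothesis depS : forall x y : bits n, (forall i, i \in S -> x i = y i) -> f x = f y.
Implicit Types (x y v : bits n) (Z X : {set 'I_n}) (e : block n) (st : seq (block n)).

Definition exact_block e : Prop := exists (t : 'I_n) (c : bool),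
  [/\ t \in S, t \in e.1, forall i, i \in S -> i \in e.1 -> i = t &
      forall y, f (mix e.1 y e.2) = y t (+) c].

Lemma always_decode e t c y : (forall z, f (mix e.1 z e.2) = z t (+) c) ->
  always f (decode e y) (fun b => b = y t).
Proof.
by move=> E z /=; rewrite !E !ffunE; case: (y t) (z t) (c) => -[] [].
Qed.

Lemma always_dictator_test e : exact_block e -> always f (dictator_test e) is_true.
Proof.
move=> [t [c [_ _ _ E]]]; apply: always_both => u w.
  by rewrite /= !E !ffunE; case: (u t) (w t) (c) => -[] [].
change (always f (bind (decode e u) (fun a => bind (decode e w) (fun b =>
  bind (decode e (band u w)) (fun c => Ret (c == a && b))))) is_true).
apply: always_bind (always_decode u E) => _ ->.
apply: always_bind (always_decode w E) => _ ->.
by apply: always_bind (always_decode (band u w) E) => _ -> /=; rewrite ffunE eqxx.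
Qed.

Lemma supp_cons e st : supp (e :: st) = e.1 :|: supp st.
Proof. by rewrite /supp big_cons. Qed.

(** Overwriting a block with the bit of its only relevant coordinate does not change the value of
    [f]. *)
Lemma always_spread_check m st x y b : (forall e, e \in st -> exact_block e) ->
  f (mix (supp st) x y) = b -> always f (spread_check m st x y b) is_true.
Proof.
elim: st y => [|e st IH] y hst hb.
  by rewrite /= -hb; apply/eqP/depS => i _; rewrite ffunE /supp big_nil inE.
have [t [c [tS te tU E]]] := hst e (mem_head _ _).
change (always f (bind (decode e x) (fun c' =>
  both (rep m (bind (decode e x) (fun c => Ret (c == c'))))
       (spread_check m st x (mix e.1 [ffun=> c'] y) b))) is_true).
apply: always_bind (always_decode x E) => _ ->; apply: always_both.
  apply: always_rep; apply: always_bind (always_decode x E) => _ -> /=; exact: eqxx.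
apply: IH => [e' he'|]; first by apply: hst; rewrite inE he' orbT.
rewrite -hb; apply: depS => i iS; rewrite !ffunE supp_cons inE.
by case: (boolP (i \in e.1)) => [/(tU i iS) ->|_]; case: ifP.
Qed.

Lemma always_verify T m st : (forall e, e \in st -> exact_block e) ->
  always f (verify T m st) is_true.
Proof.
move=> hst; apply: always_both.
  elim: st hst => // e st IH hst; apply: always_both.
    by apply: always_rep; apply: always_dictator_test; apply: hst; exact: mem_head.
  by apply: IH => e' he'; apply: hst; rewrite inE he' orbT.
by apply: always_rep => x; apply: always_spread_check.
Qed.

Lemma always_scan L X : always f (scan L X) (fun o =>
  if o is Some (x, a) then f x = a /\ f (cut X x) != a else True).
Proof.
elim: L => //= L IH x; case: eqP => [//|ne] /=.
by split=> //; apply/eqP => E; apply: ne.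
Qed.

Lemma always_search ss Z (a b : bits n) : f a != f b ->
  (forall i, i \notin Z -> a i = b i) ->
  always f (search ss Z a b (f a)) (fun e => [/\ e.1 \subset Z,
    exists2 b', f e.2 != f b' & forall i, i \notin e.1 -> e.2 i = b' i &
    forall s i j, s \in ss -> i \in e.1 -> j \in e.1 -> s i = s j]).
Proof.
elim: ss Z a b => [|s ss IH] Z a b hab agr /=; first by split=> //; exists b.
set Z1 := [set i in Z | s i]; set c := mix Z1 b a.
have Z1Z : Z1 \subset Z by apply/subsetP=> i; rewrite inE => /andP[].
case: eqP => [ca|/eqP ca] /=.
  have agr' i : i \notin Z :\: Z1 -> c i = b i.
    rewrite ffunE in_setD negb_and negbK; case: ifP => //= _; exact: agr.
  have hcb : f c != f b by rewrite ca.
  rewrite -ca; apply: always_impl (IH (Z :\: Z1) c b hcb agr') => e [sub hb' sep].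
  split=> // [|s' i j]; first exact: subset_trans sub (subsetDl _ _).
  rewrite inE => /predU1P[->|]; last exact: sep.
  move=> /(subsetP sub) + /(subsetP sub); rewrite !inE.
  by do 2 case: (_ \in Z); case: (s i); case: (s j).
have hac : f a != f c by rewrite eq_sym.
have agr' i : i \notin Z1 -> a i = c i by rewrite ffunE => /negPf ->.
apply: always_impl (IH Z1 a c hac agr') => e [sub hb' sep].
split=> // [|s' i j]; first exact: subset_trans sub Z1Z.
rewrite inE => /predU1P[->|]; last exact: sep.
by move=> /(subsetP sub) + /(subsetP sub); rewrite !inE => /andP[_ ->] /andP[_ ->].
Qed.

Definition separates (ss : seq (bits n)) : Prop := forall i j, i \in S -> j \in S ->
  (forall s : bits n, s \in ss -> s i = s j) -> i = j.

(** Since [f] separates two points agreeing off the block, they differ at a relevant coordinate [t]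
    inside it. Separation makes [t] the only one, and both values of [f] occur, so the restriction
    is a literal in [t]. *)
Lemma exact_block_of_search ss e : separates ss ->
  (exists2 b, f e.2 != f b & forall i, i \notin e.1 -> e.2 i = b i) ->
  (forall s i j, s \in ss -> i \in e.1 -> j \in e.1 -> s i = s j) -> exact_block e.
Proof.
move=> sep [b hb agr] hcell.
have [t /andP[tS tb]|same] := pickP (fun i => (i \in S) && (e.2 i != b i)); last first.
  case/eqP: hb; apply: depS => i iS; apply/eqP; move: (same i); rewrite iS /=.
  by move/negbFE.
have te : t \in e.1 by apply: contraR tb => /agr ->.
have tU i : i \in S -> i \in e.1 -> i = t.
  by move=> iS ie; apply: sep => // s hs; exact: hcell.
pose phi (c : bool) := f (mix e.1 [ffun=> c] e.2).
have phiE y : f (mix e.1 y e.2) = phi (y t).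
  apply: depS => i iS; rewrite !ffunE; by case: ifP => // /(tU i iS) ->.
have phi1 : f e.2 = phi (e.2 t).
  rewrite -phiE; apply: depS => i _; rewrite ffunE; by case: ifP.
have phi2 : f b = phi (b t).
  rewrite -phiE; apply: depS => i _; rewrite ffunE; by case: ifP => // /negbT/agr.
exists t, (phi false); split=> // y; rewrite phiE.
move: hb tb; rewrite phi1 phi2.
by case: (e.2 t); case: (b t); case: (y t); case: (phi true); case: (phi false).
Qed.

(** The last hypothesis is the invariant: every new block lies off the support and contributes a new
    relevant coordinate. A block found with no fuel left would yield more than [#|S|] of them. *)
Lemma always_explore L T m ss fuel st : separates ss -> (#|S| <= size st + fuel)%N ->
  (forall e, e \in st -> exact_block e) -> (size st <= #|S :&: supp st|)%N ->
  always f (explore L T m ss fuel st) is_true.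
Proof.
move=> sep; elim: fuel st => [|fuel IH] st hk hst hsz.
all: apply: always_bind (always_scan L (supp st)) => -[[x a] [<- hx]|_];
  last exact: always_verify.
all: have agr i : i \notin ~: supp st -> x i = cut (supp st) x i
  by rewrite inE negbK ffunE => ->.
all: rewrite eq_sym in hx; apply: always_bind (always_search ss hx agr) => e [sub hb hc].
all: have he : exact_block e := exact_block_of_search sep hb hc.
all: have hsz' : (size (e :: st) <= #|S :&: supp (e :: st)|)%N.
1,3: have [t [c [tS te _ _]]] := he; apply: leq_ltn_trans hsz _; apply: proper_card.
1,2: apply/properP; split; first by rewrite supp_cons setIS // subsetUr.
1,2: exists t; rewrite ?supp_cons !inE ?tS ?te //=.
1,2: by move/(subsetP sub): te; rewrite inE.
- have := leq_trans hsz' (subset_leq_card (subsetIl _ _)).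
  by rewrite addn0 in hk; rewrite /= ltnNge hk.
apply: IH => //; first by rewrite /= addSnnS.
by move=> e'; rewrite inE => /predU1P[->//|]; exact: hst.
Qed.

(** Flipping bit [i] preserves the uniform measure and negates the event. *)
Lemma mean_coord_eq (i j : 'I_n) : i != j ->
  mean (fun z : bits n => (z i == z j)%:R) = 1 / 2.
Proof.
move=> ij; have : mean (fun z : bits n => (z i == z j)%:R) =
    1 - mean (fun z : bits n => (z i == z j)%:R).
  rewrite -mean_negb -{1}(mean_shift (bunit i)); apply: eq_mean => z.
  by rewrite !ffunE eqxx eq_sym [j == i]eq_sym (negPf ij); case: (z i) (z j) => -[].
lra.
Qed.

Lemma ex_coins_collide D (i j : 'I_n) p : i != j ->
  ex D f (coins n p) (fun ss => (all (fun s : bits n => s i == s j) ss)%:R) = (1 / 2) ^+ p.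
Proof.
move=> ij; elim: p => //= p IH.
transitivity (mean (fun z : bits n => (1 / 2) ^+ p * (z i == z j)%:R)).
  apply: eq_bigr => z _; congr (_ * _); rewrite ex_bind /=.
  rewrite -IH -exZr; apply: eq_ex => ss /=.
  by case: (_ == _); rewrite /= ?mulr1 ?mulr0.
by rewrite meanZ mean_coord_eq // exprSr.
Qed.

(** A union bound over ordered pairs of distinct elements of [S], each of which shares a cell with
    probability [(1 / 2) ^+ p]; without a collision acceptance is certain. *)
Lemma junta_test_complete D L T m p k : is_distr D -> (#|S| <= k)%N ->
  1 - (k * k)%:R * (1 / 2) ^+ p <= pr D f (junta_test n L T m p k).
Proof.
move=> hD hk; rewrite /pr ex_bind.
pose Q := [pred ij : 'I_n * 'I_n | [&& ij.1 \in S, ij.2 \in S & ij.1 != ij.2]].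
pose col (ij : 'I_n * 'I_n) (ss : p.-tuple (bits n)) : R :=
  (all (fun s : bits n => s ij.1 == s ij.2) ss)%:R.
apply: le_trans (_ : ex D f (coins n p) (fun ss => (\sum_(ij | Q ij) col ij ss) * -1 + 1) <= _).
  rewrite exD ex_const // exZr ex_sum mulrN1 addrC lerD2r lerN2.
  under eq_bigr => ij /and3P[_ _ ij_neq] do rewrite /col ex_coins_collide //.
  rewrite sumr_const -[leLHS]mulr_natl; apply: ler_wpM2r; first by apply: exprn_ge0; lra.
  rewrite ler_nat; apply: leq_trans (_ : #|setX S S| <= _)%N; last by rewrite cardsX leq_mul.
  by apply/subset_leq_card/subsetP => -[i j]; rewrite !inE => /and3P[-> ->].
apply: ex_mono => // ss.
have col0 ij : 0 <= col ij ss by exact: ler0n.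
have [/existsP[ij /andP[hQ hall]]|none] :=
  boolP [exists ij, Q ij && all (fun s : bits n => s ij.1 == s ij.2) ss].
  have colE : col ij ss = 1 by rewrite /col hall.
  rewrite (bigD1 ij) //= colE.
  have := pr_ge0 hD f (explore L T m ss k [::]); rewrite /pr.
  move: (ex _ _ _ _) => r.
  have : 0 <= \sum_(i | Q i && (i != ij)) col i ss by apply: sumr_ge0.
  by lra.
apply: le_trans (_ : 1 <= _).
  by have : 0 <= \sum_(ij | Q ij) col ij ss by [apply: sumr_ge0]; lra.
apply: (always_ex hD (P := is_true)) => [b -> //|]; apply: always_explore => //.
move=> i j iS jS hss; apply/eqP/contraT => ij; case/negP: none.
apply/existsP; exists (i, j); rewrite /= iS jS ij /=.
by apply/allP => s /hss ->.
Qed.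

End Completeness.

(** * Query complexity and parameters *)

Section QueryComplexity.
Variable n : nat.
Implicit Types (x y : bits n) (X Z : {set 'I_n}) (e : block n) (st : seq (block n)).

Lemma qbound_decode e y : qbound (decode e y) 2.
Proof. by []. Qed.

Lemma qbound_dictator_test e : qbound (dictator_test e) 10.
Proof. exact: (@qbound_both n (affine_test e) (mult_test e) 4 6). Qed.

Lemma qbound_dictator_tests st : qbound (dictator_tests st) (size st * 3200).
Proof.
elim: st => // e st IH; rewrite [size _]/= mulSn.
exact: (qbound_both (qbound_rep 320 (qbound_dictator_test e)) IH).
Qed.

Lemma qbound_spread_check m st x y t :
  qbound (spread_check m st x y t) (size st * (2 * m).+2 + 1).
Proof.
elim: st y => // e st IH y; rewrite [size _]/= mulSn -addnA -addn2 [(2 * m + 2)%N]addnC -addnA.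
apply: (qbound_bind (qbound_decode e x)) => b; apply: qbound_both; last exact: IH.
by rewrite mulnC; apply: qbound_rep.
Qed.

Lemma qbound_verify T m st : qbound (verify T m st)
  (size st * 3200 + T * (1 + (size st * (2 * m).+2 + 1))).
Proof.
apply: qbound_both; first exact: qbound_dictator_tests.
by apply: qbound_rep => x b; exact: qbound_spread_check.
Qed.

Lemma qbound_scan L X : qbound (scan L X) (2 * L).
Proof.
elim: L => // L IH; rewrite mulnS => x a b /=.
by case: ifP.
Qed.

Lemma qbound_search ss Z (a b : bits n) fa : qbound (search ss Z a b fa) (size ss).
Proof. by elim: ss Z a b => //= s ss IH Z a b fc; case: ifP. Qed.

Lemma qbound_explore L T m ss k fuel st : (size st + fuel <= k)%N ->
  qbound (explore L T m ss fuel st)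
    (fuel.+1 * (2 * L + size ss) + (k * 3200 + T * (1 + (k * (2 * m).+2 + 1)))).
Proof.
have hV st' : (size st' <= k)%N ->
    qbound (verify T m st') (k * 3200 + T * (1 + (k * (2 * m).+2 + 1))).
  move=> hk; apply: qboundW (qbound_verify T m st').
  by rewrite leq_add ?leq_mul ?leq_add ?leq_mul.
elim: fuel st => [|fuel IH] st hk; rewrite exploreE;
  rewrite [X in (X + _)%N]mulSn -addnA -[X in qbound _ X]addnA.
all: apply: (qbound_bind (qbound_scan L (supp st))) => -[[x a]|].
2,4: apply: qboundW (hV st _); last by apply: leq_trans hk; rewrite leq_addr.
2,3: exact: leq_trans (leq_addl _ _) (leq_addl _ _).
- by apply: (qbound_bind (qbound_search _ _ _ _ _)) => e.
apply: (qbound_bind (qbound_search _ _ _ _ _)) => e.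
by apply: IH; rewrite [size _]/= addSnnS.
Qed.

Lemma qbound_coins p : qbound (coins n p) 0.
Proof. by elim: p => //= p IH z; apply: (qbound_bind IH). Qed.

Lemma qbound_junta_test L T m p k : qbound (junta_test n L T m p k)
  (k.+1 * (2 * L + p) + (k * 3200 + T * (1 + (k * (2 * m).+2 + 1)))).
Proof.
rewrite -[X in qbound _ X]add0n; apply: (qbound_bind (qbound_coins p)) => ss.
by rewrite -{2}(size_tuple ss); apply: qbound_explore.
Qed.

End QueryComplexity.

Lemma ln_ge0 (y : R) : 1 <= y -> 0 <= Rpower.ln y.
Proof.
rewrite le_eqVlt => /predU1P[<-|/RltP y1]; first by rewrite Rpower.ln_1.
by apply/ltW; have /RltP := Rpower.ln_increasing _ _ RIneq.Rlt_0_1 y1; rewrite Rpower.ln_1.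
Qed.

(** Halving [y] costs [ln 2], which exceeds 1/2. This converts binary logarithms in the query count
    to natural ones. *)
Lemma half_le_ln (j : nat) (y : R) : 2 ^+ j <= y -> j%:R / 2 <= Rpower.ln y.
Proof.
elim: j y => [|j IH] y hy; first by rewrite mul0r; exact: ln_ge0.
have y0 : 0 < y by apply: lt_le_trans hy; rewrite exprn_gt0.
have y2 : 0 < y / 2 by lra.
have h2 : (0 : R) < 2 by lra.
have lnE : Rpower.ln y = Rpower.ln 2 + Rpower.ln (y / 2).
  have {1}-> : y = 2 * (y / 2) by lra.
  by apply: Rpower.ln_mult; apply/RltP.
have ln2 : 1 / 2 < Rpower.ln 2.
  have /RltP := Rpower.ln_lt_2.
  by rewrite RinvE -[Rdefinitions.IZR _]/(2 : R); lra.
have /IH : 2 ^+ j <= y / 2 by rewrite exprS in hy; lra.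
by rewrite lnE -[j.+1%:R]natr1; lra.
Qed.

(** * Choice of the parameters *)

Section Calibration.
Variables (k : nat) (eps : R).
Hypotheses (eps0 : 0 < eps) (eps1 : eps <= 1).

Definition lg (k : nat) : nat := (trunc_log 2 k.+1).+1.
Definition inv_ceil (eps : R) : nat := (Num.truncn eps^-1).+1.

(** As [(1 - eps / 2) ^+ (2 * E) <= 1 / 2], a scan errs with probability at most
    [(1 / 2) ^+ (l + 4)], so [k.+1] scans cost at most 1/16. The factor 40 gives
    [T * eps / 4 >= 10], and [2l + 2] random points bound the collision probability by 1/4. *)
Definition junta_tester (n : nat) : prog n bool :=
  let E := inv_ceil eps in let l := lg k in
  junta_test n (2 * E * (l + 4)) (40 * E) l.+1 (2 * l).+2 k.

Lemma lg_half : k.+1%:R * (1 / 2) ^+ lg k <= 1 :> R.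
Proof.
have : (k.+1 <= 2 ^ lg k)%N by rewrite ltnW // trunc_log_ltn.
rewrite -(ler_nat R) natrX => /ler_wpM2r -/(_ ((1 / 2) ^+ lg k)) h.
apply: le_trans (h _) _; first by apply: exprn_ge0; lra.
by rewrite -exprMn (_ : 2 * (1 / 2) = 1) ?expr1n //; lra.
Qed.

Lemma inv_ceil_ge : 1 <= (inv_ceil eps)%:R * eps.
Proof. by rewrite -ler_pdivrMr // mul1r ltW // truncnS_gt. Qed.

Lemma inv_ceil_le : (inv_ceil eps)%:R <= 2 / eps.
Proof.
have i0 : 0 <= eps^-1 by rewrite invr_ge0 ltW.
have i1 : 1 <= eps^-1 by rewrite invf_ge1.
by rewrite /inv_ceil -natr1; have /andP[] := truncn_itv i0; lra.
Qed.

Lemma lg_le_ln : (lg k)%:R <= 4 * Rpower.ln (2 + k.+1%:R / eps).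
Proof.
have x1 : k.+1%:R <= k.+1%:R / eps.
  by rewrite ler_pdivlMr // -[leRHS]mulr1; apply: ler_wpM2l.
have h1 : 2 ^+ 1 <= 2 + k.+1%:R / eps by move: (ler0n R k.+1); lra.
have h2 : 2 ^+ trunc_log 2 k.+1 <= 2 + k.+1%:R / eps.
  have : (2 ^ trunc_log 2 k.+1 <= k.+1)%N by apply: trunc_logP.
  by rewrite -(ler_nat R) natrX; lra.
(* Both summands of [lg k], the 1 and the truncated logarithm, are at most twice the natural
   logarithm. *)
by move: (half_le_ln h1) (half_le_ln h2); rewrite /lg -[(trunc_log _ _).+1%:R]natr1; lra.
Qed.

Lemma query_count E l : (0 < E)%N -> (0 < l)%N ->
  (k.+1 * (2 * (2 * E * (l + 4)) + (2 * l).+2) +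
    (k * 3200 + 40 * E * (1 + (k * (2 * l.+1).+2 + 1))) <= 60 * (60 * (k.+1 * E * l)))%N.
Proof. nia. Qed.

Lemma junta_tester_queries n : exists2 q : nat, qbound (junta_tester n) q &
  q%:R <= 60 * 60 * 8 * (k.+1%:R / eps) * Rpower.ln (2 + k.+1%:R / eps).
Proof.
eexists; first exact: qbound_junta_test.
have hq := @query_count (inv_ceil eps) (lg k) isT isT.
rewrite -(ler_nat R) in hq; apply: le_trans hq _.
rewrite !natrM; have k0 : 0 <= k.+1%:R :> R by [].
have := ler_pM _ _ inv_ceil_le lg_le_ln; rewrite !ler0n => /(_ isT isT).
move/(ler_wpM2l k0) => h.
have -> : 60 * 60 * 8 * (k.+1%:R / eps) * Rpower.ln (2 + k.+1%:R / eps) =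
  60 * (60 * (k.+1%:R * (2 / eps * (4 * Rpower.ln (2 + k.+1%:R / eps))))) by lra.
by do 2!apply: ler_wpM2l => //; rewrite -[leLHS]mulrA.
Qed.

Lemma junta_tester_complete n D (f : bits n -> bool) : is_distr D -> is_junta k f ->
  2 / 3 <= pr D f (junta_tester n).
Proof.
move=> hD [S [cS depS]]; apply: le_trans (junta_test_complete depS _ _ _ _ hD cS).
have := lg_half; set h := (1 / 2) ^+ lg k.
have -> : (1 / 2 : R) ^+ (2 * lg k).+2 = h * h * (1 / 4).
  by rewrite -[(2 * lg k).+2]addn2 mul2n -addnn !exprD -/h; congr (_ * _); lra.
have h0 : 0 <= h by apply: exprn_ge0; lra.
rewrite natrM -natr1; have := ler0n R k; move: (k%:R) => r r0 hr.
have : r * h <= 1 by nra.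
have : 0 <= r * h by nra.
by nra.
Qed.

Lemma junta_tester_sound n D (f : bits n -> bool) : is_distr D ->
  far_from_juntas k eps D f -> pr D f (junta_tester n) <= 1 / 3.
Proof.
move=> hD hfar; have hE := inv_ceil_ge; have hl := lg_half.
have h0 j : 0 <= (1 / 2 : R) ^+ j by apply: exprn_ge0; lra.
apply: le_trans (@junta_test_sound n D hD f k eps eps0 eps1 hfar _ _ _
  ((1 / 2) ^+ (lg k + 4)) _ _ _ _) _.
- by rewrite natrM; lra.
- apply: le_trans (_ : k.+1%:R * (1 / 2) ^+ (lg k).+1 <= _); last first.
    by move: hl; rewrite [_ ^+ (lg k).+1]exprSr; move: (_ ^+ lg k) => r; lra.
  apply: ler_pM => //; [by apply: exprn_ge0; lra | by rewrite ler_nat |].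
  by apply: lerXn2r; rewrite ?nnegrE; lra.
- move=> x x0 xle; rewrite exprM; apply: lerXn2r; rewrite ?nnegrE; [exact: exprn_ge0|lra|].
  have e2 : 0 <= eps / 2 by move: eps0; lra.
  have := expr_decay (2 * inv_ceil eps) e2 x0 xle; rewrite natrM.
  have := exprn_ge0 (2 * inv_ceil eps) x0; move: (x ^+ _) => r r0.
  have := ler_wpM2l r0 hE; lra.
have -> : (1 / 2 : R) ^+ (lg k + 4) = (1 / 2) ^+ lg k * (1 / 16).
  by rewrite exprD; congr (_ * _); lra.
(* The total error is at most 1/16 + 1/11, below 1/3. *)
by move: hl; move: (_ ^+ lg k) => r; lra.
Qed.

End Calibration.

Lemma not_far_from_juntas n k (eps : R) D (f : bits n -> bool) :
  1 < eps -> is_distr D -> ~ far_from_juntas k eps D f.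
Proof.
move=> eps1 [D0 D1] /(_ (fun=> false)) hfar.
have hj : is_junta k (fun _ : bits n => false) by exists set0; rewrite cards0.
have := hfar hj; apply/negP; rewrite -ltNge; apply: le_lt_trans eps1; rewrite -D1.
by rewrite [leRHS](bigID (fun x => f x != false)) lerDl sumr_ge0.
Qed.

(* There are constants C > 0 and c such that a tester family A (receiving n, k, eps)
   exists that, for every n, k and eps > 0, makes at most
   C * x * (Rpower.ln (2 + x))^c queries, x = (k+1)/eps  (i.e. O~(k/eps), independent of n),
   accepts every k-junta w.p. >= 2/3 and rejects w.p. >= 2/3 every f that is
   eps-far from all k-juntas w.r.t. D, for every distribution D. *)
Theorem theorem1 :
  exists (C : R) (c : nat), 0 < C /\
  exists A : forall n : nat, nat -> R -> tester n,
  forall (n k : nat) (eps : R), 0 < eps ->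
    max_queries (A n k eps)
      (C * (k.+1%:R / eps) * (Rpower.ln (2 + k.+1%:R / eps)) ^+ c) /\
    (forall (D : bits n -> R) (f : bits n -> bool),
        is_distr D -> is_junta k f -> 2 / 3 <= acc_prob (A n k eps) D f) /\
    (forall (D : bits n -> R) (f : bits n -> bool),
        is_distr D -> far_from_juntas k eps D f ->
        2 / 3 <= 1 - acc_prob (A n k eps) D f).
Proof.
(* The factor 3600 comes from [query_count], and 8 is the product of the constants 2 in
   [inv_ceil_le] and 4 in [lg_le_ln]. *)
exists (60 * 60 * 8), 1%N; split; first by lra.
(* For [eps > 1] nothing is [eps]-far from the constant juntas, so accepting without queries is
   correct. *)
exists (fun n k eps => tester_of (if eps <= 1 then junta_tester k eps n else Ret true)).
move=> n k eps eps0; rewrite expr1; case: (lerP eps 1) => eps1.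
  split=> [s xs f|]; last split=> D f hD hf; rewrite ?acc_prob_tester_of //.
  - have [q hq /(le_trans _)] := junta_tester_queries k eps0 eps1 n; apply.
    by rewrite ler_nat; exact: qbound_run.
  - exact: junta_tester_complete.
  - by have := junta_tester_sound eps0 eps1 hD hf; lra.
split=> [s xs f|]; last split=> D f hD hf; rewrite ?acc_prob_tester_of //.
- have x0 : 0 <= k.+1%:R / eps by rewrite divr_ge0 // ltW.
  have hln : 0 <= Rpower.ln (2 + k.+1%:R / eps) by apply: ln_ge0; lra.
  by do 2!apply: mulr_ge0 => //; lra.
- by rewrite /pr /=; lra.
- by case: (not_far_from_juntas eps1 hD hf).
Qed.
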